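(* For integers $m,n\geq 3$, $\gamma_{P,c}(K_m\,\square\,K_{1,n})=\min\{m-1,\,n\}$.
   Context: Power domination: for $S\subseteq V(G)$, start with $M(S)=N[S]$ and repeatedly add a vertex $w$ whenever some $v\in M(S)$ has $w$ as its unique neighbour outside $M(S)$; $S$ is a connected power dominating set if the final $M(S)$ is $V(G)$ and $\langle S\rangle$ is connected; $\gamma_{P,c}(G)$ is the minimum size of such a set. The Cartesian product $G\,\square\,H$ has vertex set $V(G)\times V(H)$, with $(a,b)\sim(x,y)$ iff either $a=x$ and $by\in E(H)$, or $b=y$ and $ax\in E(G)$. $K_m$ is the complete graph on $m$ vertices and $K_{1,n}$ the star with $n$ leaves. *)

(* Defs.v *)
From mathcomp Require Import all_boot.

Set Implicit Arguments.
Unset Strict Implicit.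
Unset Printing Implicit Defensive.

Record sgraph := SGraph {
  vertex :> finType;
  adj : rel vertex;
  adj_sym : symmetric adj;
  adj_irr : irreflexive adj }.

Section PowerDomination.

Variable G : sgraph.
Implicit Types (S M : {set G}) (v w : G).

Definition nbhd v : {set G} := [set w | adj v w].

Definition closed_nbhd S : {set G} := S :|: \bigcup_(v in S) nbhd v.

Definition forces M v w : bool := (v \in M) && (nbhd v :\: M == [set w]).

(* One step of the propagation process: a single forced vertex is added. *)
Definition propagates : rel {set G} :=
  [rel M M' | [exists v, exists w, forces M v w && (M' == w |: M)]].

(* Maximal runs of the process from M all end in the same set, see
   propagation_confluent, so it is enough that some run reaches V(G). *)
Definition power_dominating S : bool :=
  connect propagates (closed_nbhd S) setT.

Definition connected_set S : bool :=
  [forall x in S, forall y in S, connect [rel u v in S | adj u v] x y].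

Definition connected_power_dominating S : bool :=
  power_dominating S && connected_set S.

(* setT is a mere default: the arg min is a smallest connected power dominating
   set as soon as there is one, that is, unless G is disconnected. *)
Definition gamma_Pc : nat :=
  #|[arg min_(S < setT | connected_power_dominating S) #|S| ]|.

Lemma propagation_confluent M M1 M2 :
    connect propagates M M1 -> connect propagates M M2 ->
    (forall M', ~~ propagates M1 M') -> (forall M', ~~ propagates M2 M') ->
  M1 = M2.
Proof.
have run_sub (A B : {set G}) : connect propagates A B -> A \subset B.
  case/connectP=> p; elim: p A => [|C p IHp] A /= => [_ -> //|].
  case/andP=> /existsP[v /existsP[w /andP[_ /eqP->]]] /IHp IH /IH.
  exact/subset_trans/subsetUr.
have sub (A B C : {set G}) : connect propagates A B -> A \subset C ->
    (forall M', ~~ propagates C M') -> B \subset C.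
  case/connectP=> p; elim: p A => [|D p IHp] A /= => [_ -> //|].
  case/andP=> /existsP[v /existsP[w /andP[/andP[Av /eqP fw] /eqP->]]] pD eB.
  move=> sAC endC; apply: (IHp _ pD eB _ endC); rewrite subUset sAC andbT sub1set.
  apply: contraT => Cw; have /negP[] := endC (w |: C).
  apply/existsP; exists v; apply/existsP; exists w.
  rewrite /forces (subsetP sAC) // eqxx andbT /= eqEsubset -{1}fw setDS //=.
  have: w \in nbhd v :\: A by rewrite fw set11.
  by rewrite sub1set !in_setD Cw => /andP[].
move=> r1 r2 e1 e2; apply/eqP; rewrite eqEsubset.
by rewrite (sub _ _ _ r1 (run_sub _ _ r2)) // (sub _ _ _ r2 (run_sub _ _ r1)).
Qed.

End PowerDomination.

Section CartesianProduct.

Variables G H : sgraph.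

Definition cart_adj : rel (G * H) := [rel p q |
  (p.1 == q.1) && adj p.2 q.2 || (p.2 == q.2) && adj p.1 q.1].

Lemma cart_adj_sym : symmetric cart_adj.
Proof.
move=> p q; rewrite /cart_adj /=.
by rewrite [p.1 == _]eq_sym [p.2 == _]eq_sym [adj p.1 _]adj_sym adj_sym.
Qed.

Lemma cart_adj_irr : irreflexive cart_adj.
Proof. by move=> p; rewrite /cart_adj /= !adj_irr !andbF. Qed.

Definition cart_prod : sgraph := SGraph cart_adj_sym cart_adj_irr.

End CartesianProduct.

Lemma complete_adj_sym m : symmetric [rel i j : 'I_m | i != j].
Proof. by move=> i j /=; rewrite eq_sym. Qed.

Lemma complete_adj_irr m : irreflexive [rel i j : 'I_m | i != j].
Proof. by move=> i /=; rewrite eqxx. Qed.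

Definition complete_graph m : sgraph :=
  SGraph (@complete_adj_sym m) (@complete_adj_irr m).

(* None is the centre of the star, Some i its leaves. *)
Definition star_adj n : rel (option 'I_n) :=
  [rel u v | (u == None) != (v == None)].

Lemma star_adj_sym n : symmetric (@star_adj n).
Proof. by move=> u v; rewrite /star_adj /= eq_sym. Qed.

Lemma star_adj_irr n : irreflexive (@star_adj n).
Proof. by move=> u; rewrite /star_adj /= eqxx. Qed.

Definition star n : sgraph := SGraph (@star_adj_sym n) (@star_adj_irr n).

(* Main.v *)
(* Upper bounds: all vertices of the central layer but one, or the whole fibre
   of the star over one vertex of K_m but one leaf, observe everything after one
   round of forcing.  Lower bound: if S misses a set A of at least two vertices
   of K_m and a set B of at least two leaves, then A x B is a fort, that is, no
   vertex outside it has exactly one neighbour in it, so that it is never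
   entered.  Connectedness provides B: S either meets the central layer or stays
   in a single leaf layer. *)
Require Import Defs.
From mathcomp Require Import all_boot.

Set Implicit Arguments.
Unset Strict Implicit.
Unset Printing Implicit Defensive.

Lemma exists_other (T : finType) (A : {set T}) (a : T) :
  1 < #|A| -> exists2 b, b \in A & b != a.
Proof.
move=> A_gt1; have /card_gt0P[b] : 0 < #|A :\ a|.
  by have := cardsD1 a A; case: (a \in A) A_gt1 => /[swap] -> //; apply: ltnW.
by rewrite !inE => /andP[ba Ab]; exists b.
Qed.

Section PowerDominationTheory.

Variable G : sgraph.
Implicit Types (S M F : {set G}) (v w : G).

Lemma gamma_Pc_eq S :
    connected_power_dominating S ->
    (forall S', connected_power_dominating S' -> #|S| <= #|S'|) ->
  gamma_Pc G = #|S|.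
Proof.
move=> cpdS minS; rewrite /gamma_Pc /arg_min /extremum; case: pickP => [S'|/(_ S)] /=.
  case/andP=> cpdS' /forallP/(_ S)/implyP/(_ cpdS) leS'.
  by apply/eqP; rewrite eqn_leq leS' minS.
(* The default [setT] of the arg min is never returned, since [S] itself is a minimiser. *)
case/negP; rewrite cpdS; apply/forallP=> S'; apply/implyP; exact: minS.
Qed.

Lemma closed_nbhdP S w :
  reflect (w \in S \/ exists2 v, v \in S & adj v w) (w \in closed_nbhd S).
Proof.
rewrite inE; apply: (iffP orP) => -[Sw|]; [by left | | by left |].
  by case/bigcupP=> v Sv; rewrite inE => vw; right; exists v.
by case=> v Sv vw; right; apply/bigcupP; exists v; rewrite ?inE.
Qed.

Lemma connected_set_star S c :
  c \in S -> (forall v, v \in S -> v = c \/ adj c v) -> connected_set S.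
Proof.
move=> Sc cS; apply/forall_inP=> x Sx; apply/forall_inP=> y Sy.
apply: (@connect_trans _ _ c).
  case: (cS x Sx) => [->//|cx]; apply: connect1.
  by rewrite /= Sx Sc adj_sym.
by case: (cS y Sy) => [->//|cy]; apply: connect1; rewrite /= Sy Sc.
Qed.

(** Observing more vertices only shrinks [nbhd v :\: M], so a force available at [M0] stays
    available until its target is observed. The forces of a single round can thus be carried out one
    by one in any order. *)
Lemma propagates_setT (M0 : {set G}) :
    (forall w, w \notin M0 -> exists2 v, v \in M0 & nbhd v :\: M0 = [set w]) ->
  connect (@propagates G) M0 setT.
Proof.
move=> force0; suff run k M :
    M0 \subset M -> #|~: M| < k -> connect (@propagates G) M setT.
  exact: run (subxx M0) (ltnSn _).
elim: k M => // k IHk M sM0M ltMk.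
have [->//|] := eqVneq M setT; rewrite -subTset => /subsetPn[w _ Mw].
have [|v M0v fv] := force0 w; first exact: contra (subsetP sM0M w) Mw.
have Mv := subsetP sM0M v M0v.
have fw : nbhd v :\: M = [set w].
  apply/eqP; rewrite eqEsubset -{1}fv setDS // sub1set in_setD Mw.
  have : w \in nbhd v :\: M0 by rewrite fv set11.
  by case/setDP.
apply: (@connect_trans _ _ (w |: M)).
  apply: connect1; apply/existsP; exists v; apply/existsP; exists w.
  by rewrite /forces Mv fw !eqxx.
apply: IHk => //; first exact: subset_trans sM0M (subsetUr _ _).
rewrite ltnS in ltMk; apply: leq_trans ltMk; apply: proper_card.
rewrite properC; apply/properP; split; first exact: subsetUr.
by exists w; rewrite ?setU11.
Qed.

Definition fort F := forall v w, v \notin F -> nbhd v :&: F != [set w].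

(** As long as [F] is wholly unobserved, a force into [F] comes from a vertex outside [F] whose only
    unobserved neighbour lies in [F]. That would be its only neighbour in [F], which a fort
    forbids. *)
Lemma fort_not_power_dominating F S :
  fort F -> F != set0 -> [disjoint closed_nbhd S & F] -> ~~ power_dominating S.
Proof.
move=> fortF /set0Pn[x Fx] disj; apply/negP=> /connectP[p].
elim: p (closed_nbhd S) disj => [|M' p IHp] M disj /=.
  by move=> _ eMT; have := disjointFl disj Fx; rewrite -eMT inE.
case/andP=> /existsP[v /existsP[w /andP[/andP[Mv /eqP fw] /eqP->]]].
apply: IHp; rewrite disjoints_subset subUset -(disjoints_subset M) disj andbT.
rewrite sub1set inE; apply/negP=> Fw.
have /negP[] := fortF v w (negbT (disjointFr disj Mv)).
rewrite eqEsubset -{1}fw; apply/andP; split; last first.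
  have : w \in nbhd v :\: M by rewrite fw set11.
  by rewrite sub1set !in_setI Fw andbT => /setDP[].
by apply/subsetP=> y /setIP[vy Fy]; rewrite in_setD vy (disjointFl disj Fy).
Qed.

End PowerDominationTheory.

Section CompleteStar.

Variables m n : nat.
Local Notation G := (cart_prod (complete_graph m) (star n)).
Implicit Types (A : {set 'I_m}) (B : {set option 'I_n}) (S : {set G}).

Lemma adj_complete_star (p q : G) :
  adj p q = (p.1 == q.1) && ((p.2 == None) != (q.2 == None))
         || (p.2 == q.2) && (p.1 != q.1).
Proof. by []. Qed.

(** Suppose a vertex outside has a neighbour [(a, y)] in the product. If they share the fibre over
    [a], the outside vertex is central and sees all of [{a} x B]; if they share the layer [y], its
    first coordinate is not in [A] and it sees all of [A x {y}]. Both have at least two elements. *)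
Lemma fort_setX A B :
  1 < #|A| -> 1 < #|B| -> None \notin B -> @fort G (setX A B).
Proof.
move=> A_gt1 B_gt1 BN [i x] [a y] Fv; apply/eqP=> eF.
have: (a, y) \in @nbhd G (i, x) :&: setX A B by rewrite eF set11.
rewrite in_setI in_setX /= inE => /and3P[].
have other b z : b \in A -> z \in B -> @adj G (i, x) (b, z) -> (b, z) = (a, y).
  move=> Ab Bz ivz; apply/set1P; rewrite -eF in_setI in_setX /= Ab Bz !andbT.
  by rewrite inE.
have leaf z : z \in B -> (z == None) = false.
  by move=> Bz; apply: contraNF BN => /eqP <-.
rewrite adj_complete_star /= => /orP[] /andP[/eqP eqv vy] Aa By.
  have [z Bz zy] := exists_other y B_gt1.
  have /(other _ _ Aa Bz)[] : @adj G (i, x) (a, z).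
    by rewrite adj_complete_star /= eqv eqxx (leaf z Bz) -(leaf y By) vy.
  by apply/eqP.
have [b Ab ba] := exists_other a A_gt1.
have /(other _ _ Ab By)[] : @adj G (i, x) (b, y).
  rewrite adj_complete_star /= eqv !eqxx andbF /=.
  by apply: contraNneq Fv => ->; rewrite eqv; apply/setXP.
by apply/eqP.
Qed.

(** An edge that changes the star coordinate has an end in the central layer, so a path avoiding
    that layer keeps its star coordinate. *)
Lemma connected_leaf_layer S p q :
    connected_set S -> None \notin [set r.2 | r in S] -> p \in S -> q \in S ->
  p.2 = q.2.
Proof.
move=> /forall_inP connS SN Sp Sq.
have leaf (r : G) : r \in S -> (r.2 == None) = false.
  by move=> Sr; apply: contraNF SN => /eqP <-; apply: imset_f.
have /forall_inP/(_ q Sq)/connectP[s] := connS p Sp.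
elim: s p {Sp} => [|r s IHs] p /=; first by move=> _ ->.
case/andP=> /andP[/andP[Sp Sr] pr] rs eq_q; rewrite -(IHs r rs eq_q).
by move: (pr : @adj G p r); rewrite adj_complete_star !leaf // andbF => /andP[/eqP].
Qed.

Lemma card_cpd_geq S :
  2 < n -> connected_power_dominating S -> minn (m - 1) n <= #|S|.
Proof.
move=> n_gt2 /andP[pdS connS]; rewrite leqNgt leq_min.
apply/negP=> /andP[ltSm ltSn].
set X := [set r.1 | r in S]; set Y := None |: [set r.2 | r in S].
have leX : #|X| <= #|S| by apply: leq_imset_card.
have ltYn : #|Y| < n.
  (* If [S] meets the central layer, adding [None] costs nothing; otherwise [S] projects to at most
     one leaf, and [#|Y| <= 2 < n]. *)
  rewrite cardsU1; have [_|SN] := boolP (None \in _).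
    exact: leq_ltn_trans (leq_imset_card _ _) ltSn.
  apply: leq_ltn_trans n_gt2; rewrite ltnS.
  apply/card_le1_eqP=> _ _ /imsetP[p Sp ->] /imsetP[q Sq ->].
  by apply: esym; apply: connected_leaf_layer Sp Sq.
have A_gt1 : 1 < #|~: X|.
  by rewrite cardsCs setCK card_ord ltn_subRL addnC -ltn_subRL (leq_ltn_trans leX).
(* The star has [n + 1] vertices, so [#|Y| < n] misses at least two. *)
have B_gt1 : 1 < #|~: Y|.
  by rewrite cardsCs setCK card_option card_ord ltn_subRL addn1.
have BN : None \notin ~: Y by rewrite inE setU11.
move: pdS; apply/negP.
apply: fort_not_power_dominating (fort_setX A_gt1 B_gt1 BN) _ _.
  by rewrite -card_gt0 cardsX muln_gt0 (ltnW A_gt1) ltnW.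
(* Adjacent vertices share a coordinate, so a vertex of [N[S]] has its first coordinate in [X] or
   its second in [Y]. *)
rewrite disjoints_subset; apply/subsetP=> w Nw; rewrite in_setC.
apply/negP; rewrite inE !in_setC => /andP[Xw].
rewrite in_setU1 negb_or => /andP[wN Yw].
case/closed_nbhdP: Nw => [Sw|[v Sv]]; first by rewrite imset_f in Xw.
rewrite adj_complete_star => /orP[] /andP[/eqP eqv _].
  by rewrite -eqv imset_f in Xw.
by rewrite -eqv imset_f in Yw.
Qed.

Lemma exists_cpd_center :
  2 < m -> exists2 S : {set G}, connected_power_dominating S & #|S| = m - 1.
Proof.
move=> m_gt2; pose i1 : 'I_m := Ordinal (ltnW m_gt2).
pose i0 : 'I_m := Ordinal (ltnW (ltnW m_gt2)).
pose S : {set G} := setX [set~ i1] [set None].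
have memS i x : ((i, x) \in S) = (i != i1) && (x == None).
  by rewrite in_setX !inE.
have i01 : i0 != i1 by [].
exists S; last by rewrite cardsX cards1 muln1 cardsC1 card_ord subn1.
have NS i x : ((i, x) \in closed_nbhd S) = (i != i1) || (x == None).
  apply/closed_nbhdP/orP => [[|[[j y]]]|]; rewrite ?memS.
  - by case/andP; left.
  - case/andP=> ji /eqP->; rewrite adj_complete_star /=.
    by case/orP=> /andP[/eqP<- _]; [left | right].
  have [-> [//|/eqP->]|ii _] := eqVneq i i1.
    by right; exists (i0, None); rewrite ?memS // adj_complete_star /= eqxx.
  case: x => [j|]; last by left.
  right; exists (i, None); first by rewrite memS ii.
  by rewrite adj_complete_star /= eqxx.
apply/andP; split.
  apply: propagates_setT => -[i x]; rewrite NS negb_or negbK => /andP[/eqP-> xN].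
  (* Only the leaves over [i1] are unobserved, exactly one in each leaf layer; any other vertex of
     that layer forces it. *)
  exists (i0, x); first by rewrite NS i01.
  apply/setP=> -[j y]; rewrite in_setD NS !inE adj_complete_star /=.
  rewrite negb_or negbK xpair_eqE [y == x]eq_sym.
  have [->|_] //= := eqVneq j i1; rewrite andbT.
  by have [<-|] := eqVneq x y; rewrite ?andbF ?xN.
apply: (@connected_set_star G S (i0, None)); first by rewrite memS i01.
move=> [i x]; rewrite memS => /andP[_ /eqP->].
rewrite adj_complete_star /= andbF /=.
by have [->|] := eqVneq i0 i; [left | right].
Qed.

Lemma exists_cpd_fibre :
  0 < m -> 0 < n -> exists2 S : {set G}, connected_power_dominating S & #|S| = n.
Proof.
move=> m_gt0 n_gt0; pose i0 : 'I_m := Ordinal m_gt0.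
pose j0 : option 'I_n := Some (Ordinal n_gt0).
pose S : {set G} := setX [set i0] [set~ j0].
have memS i x : ((i, x) \in S) = (i == i0) && (x != j0).
  by rewrite in_setX !inE.
exists S; last by rewrite cardsX cards1 mul1n cardsC1 card_option card_ord.
have NS i x : ((i, x) \in closed_nbhd S) = (i == i0) || (x != j0).
  apply/closed_nbhdP/orP => [[|[[j y]]]|]; rewrite ?memS.
  - by case/andP; left.
  - case/andP=> /eqP-> yj; rewrite adj_complete_star /=.
    by case/orP=> /andP[/eqP<- _]; [left | right].
  have [-> [/eqP->|//]|xj _] := eqVneq x j0; last first.
    have [->|ii] := eqVneq i i0; first by left.
    right; exists (i0, x); first by rewrite memS eqxx xj.
    by rewrite adj_complete_star /= !eqxx /= [i0 == i]eq_sym ii orbT.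
  right; exists (i0, None); first by rewrite memS eqxx.
  by rewrite adj_complete_star.
apply/andP; split.
  apply: propagates_setT => -[i x]; rewrite NS negb_or negbK => /andP[ii /eqP->].
  (* Each fibre other than that of [i0] has [j0] as its single unobserved leaf, and the central
     layer is observed, so the centre of the fibre forces it. *)
  exists (i, None); first by rewrite NS orbT.
  apply/setP=> -[k y]; rewrite in_setD NS !inE adj_complete_star /=.
  rewrite negb_or negbK xpair_eqE [k == i]eq_sym.
  have [->|_] := eqVneq y j0; rewrite ?andbF //= !andbT orbF.
  by have [<-|] := eqVneq i k; rewrite ?andbF ?ii.
apply: (@connected_set_star G S (i0, None)); first by rewrite memS eqxx.
move=> [i x]; rewrite memS => /andP[/eqP-> _].
rewrite adj_complete_star /= eqxx /=.
by case: x => [x|]; [right | left].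
Qed.

End CompleteStar.

Theorem theorem7 (m n : nat) (hm : 3 <= m) (hn : 3 <= n) :
  gamma_Pc (cart_prod (complete_graph m) (star n)) = minn (m - 1) n.
Proof.
have [S cpdS cardS] : exists2 S : {set cart_prod (complete_graph m) (star n)},
    connected_power_dominating S & #|S| = minn (m - 1) n.
  rewrite /minn; case: ifP => _; first exact: exists_cpd_center.
  by apply: exists_cpd_fibre; apply: ltnW; apply: ltnW.
by rewrite -cardS; apply: gamma_Pc_eq => // S'; rewrite cardS; apply: card_cpd_geq.
Qed.
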